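(* Let $0<|q|<1$ and $u\in\mathbb{C}$. Then \[ \sum_{i,j,k\geq0}\frac{(-1)^{k}u^{2i+j+3k}q^{(i^{2}+j^{2}+(i+j+3k)^{2}-2i-2j-3k)/2}}{(q;q)_{i}(q;q)_{j}(q^{3};q^{3})_{k}}=\frac{(u^{3};q^{3})_{\infty}}{(u;q)_{\infty}}. \]
   Context: For $a\in\mathbb{C}$ and $|p|<1$: $(a;p)_0=1$, $(a;p)_n=\prod_{k=0}^{n-1}(1-ap^k)$, $(a;p)_\infty=\prod_{k\ge0}(1-ap^k)$. (The right side is understood as the entire function $\prod_{n\ge0}(1+uq^n+u^2q^{2n})$.) *)

(* Defs.v *)
From HB Require Import structures.
From mathcomp Require Import all_boot all_order all_algebra.
From mathcomp Require Import complex.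
From mathcomp Require Import all_classical all_reals all_analysis.
From mathcomp Require Import ring summability.

Set Implicit Arguments.
Unset Strict Implicit.
Unset Printing Implicit Defensive.

Import Order.TTheory GRing.Theory Num.Theory.
Import numFieldNormedType.Exports.

Local Open Scope classical_set_scope.
Local Open Scope complex_scope.
Local Open Scope ring_scope.

Definition qpoch (R : realType) (a p : R[i]) (n : nat) : R[i] :=
  \prod_(0 <= k < n) (1 - a * p ^+ k).

(* [R[i]] itself has no canonical topology; that of [R[i]^o] is the one given
   by the complex modulus, so limits are taken there. *)
Definition qpoch_inf (R : realType) (a p : R[i]) : R[i] :=
  limn (qpoch a p : nat -> R[i]^o).

(* (u^3;q^3)_oo / (u;q)_oo as an entire function of u, also defined at the
   zeros u = q^-n of the denominator. *)
Definition cubic_prod (R : realType) (u q : R[i]) : R[i] :=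
  limn ((fun n => \prod_(0 <= k < n) (1 + u * q ^+ k + u ^+ 2 * q ^+ (2 * k)))
        : nat -> R[i]^o).

(* The quotient by 2 is exact and its value is nonnegative: see [qexpoE]. *)
Definition qexpo (i j k : nat) : int :=
  ((i%:Z ^+ 2 + j%:Z ^+ 2 + (i%:Z + j%:Z + 3 * k%:Z) ^+ 2
    - 2 * i%:Z - 2 * j%:Z - 3 * k%:Z) %/ 2)%Z.

(* To be summed over [nat * nat * nat] as a [partial_sum] along [totally], that
   is, along the net of finite sets of indices: unconditional convergence. *)
Definition summand (R : realType) (u q : R[i]) (t : nat * nat * nat) : R[i]^o :=
  let: (i, j, k) := t in
  (-1) ^+ k * u ^+ (2 * i + j + 3 * k) * q ^ qexpo i j k
  / (qpoch q q i * qpoch q q j * qpoch (q ^+ 3) (q ^+ 3) k).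

Lemma qexpoE (i j k : nat) :
  qexpo i j k = ('C(i, 2) + 'C(j, 2) + 'C(i + j + 3 * k, 2))%N.
Proof.
have b2 n : n%:Z ^+ 2 = 'C(n, 2)%:Z * 2 + n%:Z.
  elim: n => [|n IH]; first by [].
  by rewrite binS bin1 !PoszD -addn1 PoszD sqrrD IH; ring.
have s2 := b2 (i + j + 3 * k)%N.
rewrite /qexpo (b2 i) (b2 j).
have -> : i%:Z + j%:Z + 3 * k%:Z = (i + j + 3 * k)%N by rewrite !PoszD.
rewrite s2 !PoszD -[RHS](@mulzK _ 2) //.
by congr (_ %/ _)%Z; ring.
Qed.

(* Main.v *)
Require Import Defs.
From mathcomp Require Import all_boot all_order all_algebra.
From mathcomp Require Import complex.
From mathcomp Require Import all_classical all_reals all_analysis.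
From mathcomp Require Import ring zify finmap summability.

Import Order.TTheory GRing.Theory Num.Theory.
Import numFieldNormedType.Exports.

Local Open Scope classical_set_scope.
Local Open Scope complex_scope.
Local Open Scope ring_scope.

(** Grouping the terms with [i + j + 3 k = N] turns the triple sum into
    [F(u) = sum_N q^(N choose 2) u^N c_N(u)], where [sum_N c_N(x) z^N] is
    [(-xz;q)_oo (-z;q)_oo / (-z^3;q^3)_oo], that is,
    [(-xz;q)_oo / prod_n (1 - z q^n + z^2 q^(2n))].  This product shows that
    [d = c(uq)] satisfies [c(u)_N = d_N + u d_(N-1)] and
    [d_N - d_(N-1) + d_(N-2) = q^N d_N + u q^N d_(N-1)].  Summed against
    [q^(N choose 2) u^N], the first relation gives [F(u) = A + u^2 F(uq)] with
    [A = sum_N q^(N choose 2) u^N d_N], and the second gives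
    [A = (1 + u) F(uq)].  Hence [F(u) = (1 + u + u^2) F(uq)], and iterating,
    with [F(x) -> 1] as [x -> 0], gives the product. *)

(** * Convolution of coefficient sequences *)

(** Sequences stand for formal power series in z: [conv] is their product, [shift] is multiplication
    by z, and [dil q] is the substitution of qz for z. *)
Definition conv {K : fieldType} (a b : nat -> K) (n : nat) : K :=
  \sum_(i < n.+1) a i * b (n - i)%N.

Definition shift {K : fieldType} (a : nat -> K) (n : nat) : K :=
  if n is m.+1 then a m else 0.

Definition dil {K : fieldType} (q : K) (a : nat -> K) (n : nat) : K :=
  q ^+ n * a n.

Lemma convDl {K : fieldType} (a b c : nat -> K) :
  conv (a + b) c = conv a c + conv b c.
Proof.
apply/funext => n; rewrite /conv !fctE -big_split /=.
by apply: eq_bigr => i _; rewrite mulrDl.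
Qed.

Lemma convDr {K : fieldType} (a b c : nat -> K) :
  conv a (b + c) = conv a b + conv a c.
Proof.
apply/funext => n; rewrite /conv !fctE -big_split /=.
by apply: eq_bigr => i _; rewrite mulrDr.
Qed.

Lemma convZl {K : fieldType} (x : K) (a b : nat -> K) :
  conv (fun n => x * a n) b = (fun n => x * conv a b n).
Proof.
apply/funext => n; rewrite /conv big_distrr /=.
by apply: eq_bigr => i _; rewrite mulrA.
Qed.

Lemma conv_shiftl {K : fieldType} (a b : nat -> K) :
  conv (shift a) b = shift (conv a b).
Proof.
apply/funext => -[|n]; rewrite /conv; first by rewrite big_ord1 mul0r.
by rewrite big_ord_recl mul0r add0r; apply: eq_bigr => i _.
Qed.

Lemma conv_shiftr {K : fieldType} (a b : nat -> K) :
  conv a (shift b) = shift (conv a b).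
Proof.
apply/funext => -[|n]; rewrite /conv; first by rewrite big_ord1 mulr0.
rewrite big_ord_recr /= subnn mulr0 addr0.
by apply: eq_bigr => i _; rewrite subSn // -ltnS ltn_ord.
Qed.

Lemma conv_dil {K : fieldType} (q : K) (a b : nat -> K) :
  conv (dil q a) (dil q b) = dil q (conv a b).
Proof.
apply/funext => n; rewrite /conv /dil big_distrr /=.
apply: eq_bigr => i _; rewrite mulrACA -exprD subnKC //.
by rewrite -ltnS ltn_ord.
Qed.

(** The series 1 + z is not a zero divisor, so it can be cancelled. *)
Lemma shift_fix0 {K : fieldType} (a : nat -> K) :
  a + shift a = 0 -> a = 0.
Proof.
move=> a0; apply/funext; elim=> [|n IH].
  by have := congr1 (@^~ 0%N) a0; rewrite !fctE /= addr0.
by have := congr1 (@^~ n.+1) a0; rewrite !fctE /= IH addr0.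
Qed.

(* Coefficientwise, if [f(z) = (1 + z) f(qz)] and [(1 + z^3) g(z) = g(qz)],
   then [h = f g] satisfies [(1 - z + z^2) h(z) = h(qz)]. *)
Lemma conv_cubic {K : fieldType} (q : K) (f g : nat -> K) :
  f = dil q f + shift (dil q f) ->
  g + shift (shift (shift g)) = dil q g ->
  conv f g + shift (shift (conv f g)) = shift (conv f g) + dil q (conv f g).
Proof.
move=> fE gE; set h := conv f g.
(* This is (1 + z^3) h(z) = f(z) g(qz) = (1 + z) h(qz). *)
have hE : h + shift (shift (shift h)) = dil q h + shift (dil q h).
  by rewrite /h -!conv_shiftr -convDr gE {1}fE convDl conv_shiftl conv_dil.

(* Since 1 + z^3 = (1 + z) (1 - z + z^2), the factor 1 + z cancels. *)
apply/eqP; rewrite -subr_eq0; apply/eqP/shift_fix0.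
apply/funext => n; have := congr1 (@^~ n) hE; rewrite !fctE /=.
case: n => [|n] /=; rewrite ?fctE.
  by rewrite !addr0 add0r => ->; rewrite subrr.
move=> /eqP; rewrite -subr_eq0 => /eqP H; rewrite -[RHS]H.
by case: n {H} => [|n] /=; ring.
Qed.

(** * Series and products in [R[i]] *)

(** Comparable elements of [R[i]] have equal imaginary parts, so a positive epsilon is real and
    estimates descend to [R]. *)
Lemma complex_gt0E {R : realType} (e : R[i]) :
  0 < e -> exists2 r : R, 0 < r & e = r%:C.
Proof.
case: e => a b; rewrite ltcE /= => /andP[/eqP -> a0]; by exists a.
Qed.

Lemma complex_normE {R : realType} (z : R[i]) :
  exists2 r : R, 0 <= r & `|z| = r%:C.
Proof. by exists (Normc.normc z) => //; rewrite -lecR; exact: (normr_ge0 z). Qed.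

Lemma expr_lt_eps {R : realType} (z e : R[i]) : `|z| < 1 -> 0 < e ->
  exists n0, forall n, (n0 <= n)%N -> `|z| ^+ n < e.
Proof.
have [r r0 ->] := complex_normE z.
rewrite -(rmorph1 (real_complex R)) ltcR => r1 /complex_gt0E [d d0 ->].
have /cvgrPdist_lt/(_ d d0) : (GRing.exp r : nat -> R) @ \oo --> (0 : R).
  by apply: cvg_expr; rewrite ger0_norm.
case=> n0 _ H; exists n0 => n /H /=.
by rewrite sub0r normrN ger0_norm ?exprn_ge0// -rmorphXn ltcR.
Qed.

Lemma norm_complex_le {R : realType} (a b : R) :
  `|(a +i* b)%C| <= (`|a| + `|b|)%:C.
Proof.
have -> : (a +i* b)%C = a%:C + b%:C * 'i by simpc.
rewrite (le_trans (ler_normD _ _))// normrM.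
have -> : `|'i : R[i]| = 1 by rewrite normc_def /= expr0n /= add0r expr1n sqrtr1.
by rewrite mulr1 !normc_def /= !expr0n /= !addr0 !sqrtr_sqr rmorphD.
Qed.

Lemma ler_norm_Im {R : realType} (z : R[i]) : `|complex.Im z|%:C <= `|z|.
Proof.
case: z => a b; rewrite normc_def lecR /= -sqrtr_sqr ler_wsqrtr//.
by rewrite lerDr sqr_ge0.
Qed.

(* [R[i]^o] carries no complete structure, so completeness of [R] is applied
   to the real and imaginary parts. *)
Lemma cvgn_series_half {R : realType} (a : nat -> R[i]^o) (C : R[i]) :
  (forall n, `|a n| <= C / 2 ^+ n) -> cvgn (series a).
Proof.
move=> aC.
(* The bound at n = 0 makes [C] nonnegative; adding 1 makes it the image of a positive real. *)
have /complex_gt0E[c c0 CE] : 0 < C + 1.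
  by rewrite ltr_wpDl// (le_trans (normr_ge0 _) (le_trans (aC 0%N) _))// expr0 divr1.
have {}aC n : `|a n| <= (c / 2 ^+ n)%:C.
  rewrite rmorphM fmorphV rmorphXn /= -CE rmorph_nat (le_trans (aC n))//.
  by rewrite ler_wpM2r// ?invr_ge0 ?exprn_ge0// lerDl.
have key (b : nat -> R) : (forall n, `|b n|%:C <= `|a n|) -> cvgn (series b).
  move=> ba; apply: normed_cvg; apply: (@series_le_cvg _ _ (geometric c 2^-1)).
  - by move=> n; exact: normr_ge0.
  - by move=> n; rewrite /= mulr_ge0// ?exprn_ge0// ?invr_ge0// ltW.
  - by move=> n /=; rewrite exprVn -lecR (le_trans (ba n) (aC n)).
  - by apply: is_cvg_geometric_series; rewrite ger0_norm ?invr_ge0// invf_lt1// ltr1n.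
have /cvg_ex[x cx] := key (fun n => complex.Re (a n)) (fun n => normc_ge_Re (a n)).
have /cvg_ex[y cy] := key (fun n => complex.Im (a n)) (fun n => ler_norm_Im (a n)).
apply/cvg_ex; exists (x +i* y)%C.
apply/cvgrPdist_lt => e /complex_gt0E[d d0 ->].
have d2 : 0 < d / 2 by rewrite divr_gt0.
move/cvgrPdist_lt/(_ _ d2): cx => cx; move/cvgrPdist_lt/(_ _ d2): cy => cy.
have aE n : series a n = (series (fun n => complex.Re (a n)) n +i*
   series (fun n => complex.Im (a n)) n)%C.
  rewrite /series /=; elim: n => [|m IH]; first by rewrite !big_nil.
  by rewrite !big_nat_recr //= IH; case: (a m).
near=> n; rewrite aE.
apply: le_lt_trans (norm_complex_le (x - _) (y - _)) _.
rewrite ltcR [ltRHS](splitr d) ltrD//; near: n; [exact: cx|exact: cy].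
Unshelve. all: by end_near. Qed.

Lemma norm_lim_le {R : realType} (s : nat -> R[i]^o) (l w : R[i]^o) (B : R[i]) :
  s @ \oo --> l -> (forall n, `|s n - w| <= B) -> `|l - w| <= B.
Proof.
move=> sl sB; apply/ler_addgt0Pr => e e0.
move/cvgrPdist_lt/(_ e e0): sl => -[n0 _ /(_ n0 (leqnn _)) H].
rewrite -(subrKA (s n0)) (le_trans (ler_normD _ _))// addrC lerD//.
exact: ltW.
Qed.

(** Iteration gives F(u) as the n-th partial product times F(u q^n). The last factor tends to 1,
    hence is eventually nonzero and can be divided out. *)
Lemma cvg_prod_qshift {R : realType} (q u B : R[i]) (F r : R[i] -> R[i]^o) :
  `|q| < 1 -> (forall x, F x = r x * F (x * q)) ->
  (forall x, `|x| <= `|u| -> `|F x - 1| <= B * `|x|) ->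
  ((fun n => \prod_(0 <= k < n) r (u * q ^+ k)) : nat -> R[i]^o) @ \oo --> F u.
Proof.
move=> q1 Fr F1.
have FP n : F u = \prod_(0 <= k < n) r (u * q ^+ k) * F (u * q ^+ n).
  elim: n => [|n IH]; first by rewrite big_nil mul1r expr0 mulr1.
  by rewrite big_nat_recr//= -mulrA exprSr (mulrA u) -Fr.
(* [B] may be any complex number: at a nonzero point the bound forces it to be nonnegative, and at 0
   both sides vanish. *)
have F1n n : `|1 - F (u * q ^+ n)| <= `|B| * `|u| * `|q| ^+ n.
  have h : `|u * q ^+ n| = `|u| * `|q| ^+ n by rewrite normrM normrX.
  rewrite distrC -mulrA -h (le_trans (F1 _ _))//.
    by rewrite h ler_piMr// exprn_ile1// ltW.
  have [->|x0] := eqVneq (u * q ^+ n) 0; first by rewrite normr0 !mulr0.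
  have x1 : 0 < `|u * q ^+ n| by rewrite normr_gt0.
  rewrite ler_wpM2r// real_ler_norm//.
  have := le_trans (normr_ge0 _) (F1 (u * q ^+ n) _).
  rewrite pmulr_lge0//; move=> /(_ _)/ger0_real; apply.
  by rewrite h ler_piMr// exprn_ile1// ltW.
have Fn1 : (fun n => F (u * q ^+ n)) @ \oo --> (1 : R[i]^o).
  apply/cvgrPdist_lt => e e0.
  have c0 : 0 < `|B| * `|u| + 1 by rewrite ltr_wpDl// mulr_ge0.
  have [n0 H] := expr_lt_eps q (e / (`|B| * `|u| + 1)) q1 (divr_gt0 e0 c0).
  exists n0 => // n /H /= {}H; apply: le_lt_trans (F1n n) _.
  move: H; rewrite ltr_pdivlMr// mulrC; apply: le_lt_trans.
  by rewrite ler_wpM2r ?exprn_ge0// lerDl.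
have nz : \forall n \near \oo, F (u * q ^+ n) != 0.
  move/cvgrPdist_lt/(_ 1 ltr01): Fn1; apply: filterS => n.
  by apply: contraTneq => ->; rewrite subr0 normr1 ltxx.
have -> : F u = F u * 1^-1 by rewrite invr1 mulr1.
have cF : (fun n => F u * (F (u * q ^+ n))^-1) @ \oo --> (F u * 1^-1 : R[i]^o).
  by apply: cvgM; [exact: cvg_cst | apply: cvgV Fn1; exact: oner_neq0].
refine (cvg_trans (near_eq_cvg _) cF).
apply: filterS nz => n n0 /=.
by rewrite [F u](FP n) mulfK.
Qed.

(** * Series with Gaussian weights [q^(n choose 2)] *)

(** Geometric growth, which the Gaussian weight overcomes. There is no constant in front, so |a_0|
    <= 1 and other constants go into [K]. *)
Definition tame {R : realType} (K : R[i]) (a : nat -> R[i]) : Prop :=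
  forall n, `|a n| <= K ^+ n.

Lemma tame_shift {R : realType} (K : R[i]) (a : nat -> R[i]) :
  1 <= K -> tame K a -> tame K (shift a).
Proof.
move=> K1 aK [|n] /=; first by rewrite normr0.
by rewrite (le_trans (aK n))// ler_weXn2l.
Qed.

Lemma tame_dil {R : realType} (q K : R[i]) (a : nat -> R[i]) :
  `|q| < 1 -> tame K a -> tame K (dil q a).
Proof.
move=> q1 aK n; rewrite /dil normrM normrX (le_trans _ (aK n))//.
by rewrite ler_piMl// exprn_ile1// ltW.
Qed.

Lemma tame_le {R : realType} (K L : R[i]) (a : nat -> R[i]) :
  0 <= K -> K <= L -> tame K a -> tame L a.
Proof.
move=> K0 KL aK n; rewrite (le_trans (aK n))// lerXn2r//.
by rewrite nnegrE (le_trans K0).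
Qed.

(** Each of the n + 1 products is at most K^n, and n + 1 <= 2^n. *)
Lemma tame_conv {R : realType} (K : R[i]) (a b : nat -> R[i]) :
  0 <= K -> tame K a -> tame K b -> tame (2 * K) (conv a b).
Proof.
move=> K0 aK bK n; rewrite (le_trans (ler_norm_sum _ _ _))//.
apply: (@le_trans _ _ (\sum_(i < n.+1) K ^+ n)).
  apply: ler_sum => i _; rewrite normrM.
  have in_ : (i <= n)%N by rewrite -ltnS ltn_ord.
  by rewrite -[in leRHS](subnKC in_) exprD ler_pM.
rewrite sumr_const card_ord exprMn -[leLHS]mulr_natl ler_wpM2r ?exprn_ge0//.
by rewrite -natrX ler_nat ltn_expl.
Qed.

(** The ratio of consecutive terms, |q|^n K, is eventually at most 1. The sum of the initial terms
    serves as an upper bound for each of them. *)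
Lemma gauss_bound {R : realType} (q K : R[i]) : `|q| < 1 -> 0 < K ->
  exists2 C : R[i], 0 <= C & forall n, `|q| ^+ 'C(n, 2) * K ^+ n <= C.
Proof.
move=> q1 K0; have [n0 qn0] := expr_lt_eps q K^-1 q1 ltac:(by rewrite invr_gt0).
pose b n := `|q| ^+ 'C(n, 2) * K ^+ n.
have b0 n : 0 <= b n by rewrite mulr_ge0 ?exprn_ge0// ltW.
exists (\sum_(i < n0.+1) b i) => [|n]; first exact: sumr_ge0.
have [nn0|nn0] := leqP n n0.
  rewrite -/(b n) -[n]/(val (Ordinal (nn0 : (n < n0.+1)%N))).
  by rewrite (bigD1 (Ordinal (nn0 : (n < n0.+1)%N)))//= lerDl sumr_ge0.
rewrite -/(b n) -(subnK (ltnW nn0)); elim: (n - n0)%N => [|m IH].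
  by rewrite add0n big_ord_recr /= lerDr sumr_ge0.
apply: le_trans IH; rewrite addSn /b binS bin1 exprD exprSr mulrACA ler_piMr//.
  exact: b0.
by rewrite -ler_pdivlMr// mul1r ltW// qn0// leq_addl.
Qed.

Lemma sum_half_le {R : realType} (n : nat) :
  \sum_(0 <= i < n) (2 ^+ i)^-1 <= 2 :> R[i].
Proof.
suff -> : \sum_(0 <= i < n) (2 ^+ i)^-1 = 2 - 2 / 2 ^+ n :> R[i].
  by rewrite gerBl divr_ge0// exprn_ge0.
elim: n => [|n IH]; first by rewrite big_nil expr0 divr1 subrr.
by rewrite big_nat_recr//= IH exprS; field; rewrite expf_neq0.
Qed.

(** Coefficients and point are separate arguments: in F(u), which is [theta q (cubic_coef q u) u],
    both depend on u, and the functional equations move them independently. *)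
Definition theta_term {R : realType} (q : R[i]) (a : nat -> R[i]) (x : R[i])
  (n : nat) : R[i]^o := q ^+ 'C(n, 2) * x ^+ n * a n.

Definition theta {R : realType} (q : R[i]) (a : nat -> R[i]) (x : R[i]) :
  R[i]^o := limn (series (theta_term q a x)).

Lemma theta_term_bound {R : realType} (q K U : R[i]) :
  `|q| < 1 -> 1 <= K -> 0 <= U ->
  exists2 C : R[i], 0 <= C & forall a x n, tame K a -> `|x| <= U ->
    `|theta_term q a x n| <= C / 2 ^+ n.
Proof.
move=> q1 K1 U0; have K0 : 0 < K := lt_le_trans ltr01 K1.
(* The factor 2 pays for the decay 2^-n; [U + 1] keeps the base positive when U = 0. *)
have [C C0 HC] := gauss_bound q (2 * (U + 1) * K) q1
  ltac:(by rewrite !mulr_gt0// ltr_wpDl).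
exists C => // a x n aK xU; rewrite ler_pdivlMr ?exprn_gt0//.
apply: le_trans (HC n); rewrite /theta_term !normrM !normrX -!mulrA.
rewrite ler_wpM2l ?exprn_ge0// !exprMn [leRHS]mulrC -[leRHS]mulrA.
rewrite ler_pM ?exprn_ge0 ?mulr_ge0 ?exprn_ge0//; last first.
  by rewrite ler_wpM2r ?exprn_ge0.
rewrite lerXn2r// ?nnegrE ?addr_ge0//.
by rewrite (le_trans xU)// lerDl.
Qed.

Lemma cvgn_theta {R : realType} (q K x : R[i]) (a : nat -> R[i]) :
  `|q| < 1 -> 1 <= K -> tame K a ->
  series (theta_term q a x) @ \oo --> theta q a x.
Proof.
move=> q1 K1 aK; have [C _ HC] := theta_term_bound q K `|x| q1 K1 (normr_ge0 x).
by apply: (cvgn_series_half _ C) => n; apply: HC.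
Qed.

(** The limits [s] and [t] are left free so that applications nest and two evaluations of one series
    can be compared. *)
Lemma thetaDZ {R : realType} (q x y : R[i]) (a b : nat -> R[i]) (s t : R[i]^o) :
  series (theta_term q a x) @ \oo --> s ->
  series (theta_term q b x) @ \oo --> t ->
  series (theta_term q (a + (fun n => y * b n)) x) @ \oo --> (s + y * t : R[i]^o).
Proof.
move=> sa tb.
have -> : series (theta_term q (a + (fun n => y * b n)) x) =
    (fun n => series (theta_term q a x) n + y * series (theta_term q b x) n : R[i]^o).
  apply/funext => n; rewrite /series /= big_distrr -big_split /=.
  by apply: eq_bigr => i _; rewrite /theta_term !fctE mulrDr (mulrCA y).
apply: cvgD; first exact: sa.
by apply: cvgM; [exact: cvg_cst | exact: tb].
Qed.

Lemma theta_dil {R : realType} (q x : R[i]) (a : nat -> R[i]) :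
  theta q (dil q a) x = theta q a (x * q).
Proof.
congr (limn (series _)); apply/funext => n.
by rewrite /theta_term /dil exprMn !mulrA.
Qed.

(** The weight gains q^n from n to n + 1, which moves the point from x to xq. *)
Lemma theta_shift {R : realType} (q K x : R[i]) (a : nat -> R[i]) :
  `|q| < 1 -> 1 <= K -> tame K a ->
  theta q (shift a) x = x * theta q a (x * q).
Proof.
move=> q1 K1 aK; apply: cvg_lim => //.
rewrite -(cvg_shiftS (series _)).
have -> : (fun n => series (theta_term q (shift a) x) n.+1) =
    (fun n => x * series (theta_term q a (x * q)) n : R[i]^o).
  apply/funext => n; rewrite /series /= big_nat_recl// {1}/theta_term mulr0 add0r.
  rewrite big_distrr /=; apply: eq_bigr => i _.
  by rewrite /theta_term /= binS bin1 exprD exprS exprMn; ring.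
by apply: cvgM; [exact: cvg_cst | exact: cvgn_theta K1 aK].
Qed.

(** [B] is uniform in [a] because the coefficients will vary with x. *)
Lemma theta_near0 {R : realType} (q K U : R[i]) :
  `|q| < 1 -> 1 <= K -> 0 <= U ->
  exists B : R[i], forall a x, tame K a -> a 0%N = 1 -> `|x| <= U ->
    `|theta q a x - 1| <= B * `|x|.
Proof.
move=> q1 K1 U0; have [C C0 HC] := theta_term_bound q K U q1 K1 U0.
have K0 : 0 <= K by apply: le_trans K1.
exists (2 * (K * C)) => a x aK a0 xU.
have cv := cvgn_theta q K x a q1 K1 aK.
rewrite -(cvg_shiftS (series _)) in cv.
apply: norm_lim_le cv _ => n.
rewrite /series /= big_nat_recl// {1}/theta_term expr0 a0 !mul1r.
rewrite addrAC subrr add0r (le_trans (ler_norm_sum _ _ _))//.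
(* Taking x out of the term of index m + 1 leaves a term of index m for [b]; dividing by [K] keeps
   [b] tame with the same constant. *)
pose b m := a m.+1 / K.
have bK : tame K b.
  move=> m; rewrite /b normrM normfV (ger0_norm K0) ler_pdivrMr.
    by rewrite -exprSr.
  exact: lt_le_trans ltr01 K1.
have Kn0 : K != 0 by rewrite gt_eqF// (lt_le_trans ltr01 K1).
have step m : `|theta_term q a x m.+1| <= K * `|x| * (C / 2 ^+ m).
  have -> : theta_term q a x m.+1 = K * x * q ^+ m * theta_term q b x m.
    by rewrite /theta_term /b binS bin1 exprD exprS; field.
  rewrite normrM normrM (normrM K) (ger0_norm K0) ler_pM ?mulr_ge0//.
    by rewrite ler_piMr ?mulr_ge0// normrX exprn_ile1// ltW.
  exact: HC.
apply: (@le_trans _ _ (\sum_(0 <= i < n) K * `|x| * (C / 2 ^+ i))).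
  by apply: ler_sum => i _; exact: step.
rewrite -big_distrr -big_distrr /=.
have -> : 2 * (K * C) * `|x| = K * `|x| * (C * 2) by ring.
rewrite ler_wpM2l ?mulr_ge0// ler_wpM2l//.
exact: sum_half_le.
Qed.

(** * Functional equations *)

Lemma qpochS {R : realType} (a p : R[i]) (n : nat) :
  qpoch a p n.+1 = qpoch a p n * (1 - a * p ^+ n).
Proof. by rewrite /qpoch big_nat_recr. Qed.

(** Every factor has modulus at least 1 - r. A separate [r] lets the base q^3 share the bound
    |q|. *)
Lemma qpoch_ge {R : realType} (p r : R[i]) (n : nat) :
  `|p| <= r -> r < 1 -> (1 - r) ^+ n <= `|qpoch p p n|.
Proof.
move=> pr r1; have r0 : 0 <= r by apply: le_trans pr.
elim: n => [|n IH]; first by rewrite /qpoch big_nil normr1.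
rewrite qpochS normrM exprSr ler_pM ?exprn_ge0 ?subr_ge0 ?(ltW r1)//.
rewrite (le_trans _ (lerB_dist _ _))// normr1 lerB// -exprS normrX exprS.
rewrite (le_trans _ pr)// ler_piMr// exprn_ile1//.
by rewrite (le_trans pr)// ltW.
Qed.

Lemma qpoch_neq0 {R : realType} (p : R[i]) (n : nat) :
  `|p| < 1 -> qpoch p p n != 0.
Proof.
move=> p1; rewrite -normr_gt0 (lt_le_trans _ (qpoch_ge p `|p| n _ _))//.
by rewrite exprn_gt0// subr_gt0.
Qed.

Lemma qpochV_le {R : realType} (p r : R[i]) (n : nat) :
  `|p| <= r -> r < 1 -> `|(qpoch p p n)^-1| <= (1 - r)^-1 ^+ n.
Proof.
move=> pr r1; rewrite normfV exprVn lef_pV2 ?posrE ?qpoch_ge//.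
  by rewrite normr_gt0 qpoch_neq0// (le_lt_trans pr).
by rewrite exprn_gt0// subr_gt0.
Qed.

(* The coefficient of [z^n] in [(-z;q)_oo]. *)
Definition euler_coef {R : realType} (q : R[i]) (n : nat) : R[i] :=
  q ^+ 'C(n, 2) / qpoch q q n.

(* The coefficient of [z^n] in [1 / (-z^3;q^3)_oo]. *)
Definition cube_coef {R : realType} (q : R[i]) (n : nat) : R[i] :=
  if (3 %| n)%N then (-1) ^+ (n %/ 3) / qpoch (q ^+ 3) (q ^+ 3) (n %/ 3) else 0.

Definition cubic_coef {R : realType} (q x : R[i]) : nat -> R[i] :=
  conv (fun n => x ^+ n * euler_coef q n) (conv (euler_coef q) (cube_coef q)).

Lemma norm_exp3_le {R : realType} (q : R[i]) : `|q| < 1 -> `|q ^+ 3| <= `|q|.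
Proof. by move=> q1; rewrite normrX exprS ler_piMr// exprn_ile1// ltW. Qed.

Lemma euler_coefS {R : realType} (q : R[i]) (n : nat) : `|q| < 1 ->
  euler_coef q n.+1 * (1 - q ^+ n.+1) = q ^+ n * euler_coef q n.
Proof.
move=> q1; have := qpoch_neq0 q n.+1 q1; have := qpoch_neq0 q n q1.
rewrite /euler_coef qpochS binS bin1 exprD -exprS mulf_eq0 negb_or.
by move=> _ /andP[_ n0]; rewrite invfM !mulrA mulfVK // [_ * q ^+ n]mulrC.
Qed.

(** For e(z) = (-xz;q)_oo this is e(z) = (1 + xz) e(qz). *)
Lemma euler_coef_rel {R : realType} (q x : R[i]) : `|q| < 1 ->
  let e := fun n => x ^+ n * euler_coef q n in
  e = dil q e + (fun n => x * shift (dil q e) n).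
Proof.
move=> q1 e; apply/funext => -[|n]; rewrite !fctE /dil /e /=.
  by rewrite !expr0 mulr0 addr0 !mul1r.
have := euler_coefS q n q1; rewrite mulrBr mulr1 => /eqP; rewrite subr_eq.
by move=> /eqP {1}->; rewrite exprS; ring.
Qed.

(** For g(z) = 1 / (-z^3;q^3)_oo this is (1 + z^3) g(z) = g(qz). *)
Lemma cube_coef_rel {R : realType} (q : R[i]) : `|q| < 1 ->
  cube_coef q + shift (shift (shift (cube_coef q))) = dil q (cube_coef q).
Proof.
move=> q1; apply/funext => n; rewrite !fctE /dil.
case: n => [|[|[|n]]] /=; rewrite ?addr0 ?expr0 ?mul1r//.
- by rewrite /cube_coef /= mulr0.
- by rewrite /cube_coef /= mulr0.
rewrite /cube_coef -(addn3 n) dvdn_addl// divnDr// divnn /= addn1.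
case: ifP => [/dvdnP[k ->]|_]; last by rewrite addr0 mulr0.
rewrite mulnK// exprS qpochS.
have q3 : `|q ^+ 3| < 1 by rewrite (le_lt_trans (norm_exp3_le q q1)).
have := qpoch_neq0 (q ^+ 3) k.+1 q3; have := qpoch_neq0 (q ^+ 3) k q3.
have -> : q ^+ (k * 3 + 3) = q ^+ 3 * (q ^+ 3) ^+ k by rewrite -exprM -exprD mulnC addnC.
rewrite qpochS mulf_eq0 negb_or.
by move: (q ^+ 3) => b _ /andP[n1 n2]; field; rewrite n1 n2.
Qed.

(** Only the factor (-xz;q)_oo = (1 + xz) (-xqz;q)_oo involves x. *)
Lemma cubic_coef_dil {R : realType} (q x : R[i]) : `|q| < 1 ->
  cubic_coef q x = cubic_coef q (x * q) +
    (fun n => x * shift (cubic_coef q (x * q)) n).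
Proof.
move=> q1; rewrite /cubic_coef; set h := conv _ (cube_coef q).
have -> : (fun n => (x * q) ^+ n * euler_coef q n) =
    dil q (fun n => x ^+ n * euler_coef q n).
  by apply/funext => n; rewrite /dil exprMn mulrAC mulrC mulrA.
by rewrite {1}(euler_coef_rel q x q1) convDl convZl conv_shiftl.
Qed.

(** In generating functions, (1 - z + z^2) c(z) = (1 + xz) c(qz), written without subtraction. *)
Lemma cubic_coef_rel {R : realType} (q x : R[i]) : `|q| < 1 ->
  let c := cubic_coef q x in
  c + shift (shift c) = shift c + (dil q c + (fun n => x * shift (dil q c) n)).
Proof.
move=> q1 c; rewrite /c /cubic_coef; set h := conv _ (cube_coef q).
set e := fun n => x ^+ n * euler_coef q n.
have fE : euler_coef q = dil q (euler_coef q) + shift (dil q (euler_coef q)).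
  have := euler_coef_rel q 1 q1.
  have -> : (fun n => 1 ^+ n * euler_coef q n) = euler_coef q.
    by apply/funext => n; rewrite expr1n mul1r.
  move=> {1}->; congr (_ + _); apply/funext => n; exact: mul1r.
have hE := conv_cubic q _ _ fE (cube_coef_rel q q1); rewrite -/h in hE.
rewrite -!(conv_shiftr e) -convDr hE convDr; congr (_ + _).
by rewrite {1}/e (euler_coef_rel q x q1) -/e convDl convZl conv_shiftl conv_dil.
Qed.

(** * Growth of the coefficients *)

Lemma tame_euler {R : realType} (q x U : R[i]) :
  `|q| < 1 -> `|x| <= U -> tame (U / (1 - `|q|)) (fun n => x ^+ n * euler_coef q n).
Proof.
move=> q1 xU n; rewrite normrM /euler_coef normrM exprMn ler_pM//.
  by rewrite normrX lerXn2r// nnegrE (le_trans _ xU).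
rewrite (le_trans _ (qpochV_le q `|q| n _ q1))// ler_piMl//.
by rewrite normrX exprn_ile1// ltW.
Qed.

Lemma tame_cube {R : realType} (q : R[i]) :
  `|q| < 1 -> tame (1 - `|q|)^-1 (cube_coef q).
Proof.
move=> q1 n; have r1 : 1 <= (1 - `|q|)^-1.
  by rewrite invf_ge1 ?subr_gt0// gerBl.
rewrite /cube_coef; case: ifP => _; last first.
  by rewrite normr0 exprn_ge0// (le_trans _ r1).
rewrite normrM normrX normrN1 expr1n mul1r.
rewrite (le_trans (qpochV_le (q ^+ 3) `|q| _ (norm_exp3_le q q1) q1))//.
by rewrite ler_weXn2l// leq_div.
Qed.

Lemma tame_cubic {R : realType} (q U : R[i]) : `|q| < 1 -> 0 <= U ->
  exists2 K : R[i], 1 <= K & forall x, `|x| <= U -> tame K (cubic_coef q x).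
Proof.
(* [K] serves all three factors: [U + 1] bounds both |x| and 1, the second factor being the first at
   x = 1. Each convolution then doubles the constant. *)
move=> q1 U0; set V := (1 - `|q|)^-1; set K := (U + 1) * V.
have V1 : 1 <= V by rewrite invf_ge1 ?subr_gt0// gerBl.
have U1 : 1 <= U + 1 by rewrite lerDr.
have K1 : 1 <= K by rewrite mulr_ege1.
have K0 : 0 <= K by apply: le_trans K1.
have V0 : 0 <= V by apply: le_trans V1.
have VK : V <= K by rewrite ler_peMl.
have twoK (L : R[i]) : 0 <= L -> L <= 2 * L by move=> L0; rewrite ler_peMl// ler1n.
exists (2 * (2 * K)); first by rewrite !mulr_ege1// ler1n.
move=> x xU; apply: tame_conv; first exact: mulr_ge0.
  have xU1 : `|x| <= U + 1 by rewrite (le_trans xU)// lerDl.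
  exact: (tame_le K _ _ K0 (twoK K K0) (tame_euler q x _ q1 xU1)).
apply: tame_conv => //; last exact: (tame_le V _ _ V0 VK (tame_cube q q1)).
have := tame_euler q 1 (U + 1) q1; rewrite normr1 => /(_ U1).
by move=> H n; have := H n; rewrite expr1n mul1r.
Qed.

(** * Functional equations and product expansions of the theta sums *)

Lemma theta_cubicE {R : realType} (q x : R[i]) : `|q| < 1 ->
  theta q (cubic_coef q x) x =
  (1 + x + x ^+ 2) * theta q (cubic_coef q (x * q)) (x * q).
Proof.
move=> q1; set d := cubic_coef q (x * q).
have [K K1 HK] := tame_cubic q `|x| q1 (normr_ge0 x).
have dK : tame K d.
  by apply: HK; rewrite normrM ler_piMr// ltW.
have ddK := tame_dil q K d q1 dK.
have cv b z : tame K b -> series (theta_term q b z) @ \oo --> theta q b z.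
  exact: cvgn_theta.
have dS b z : tame K b -> series (theta_term q (shift b) z) @ \oo -->
    (z * theta q b (z * q) : R[i]^o).
  by move=> bK; rewrite -(theta_shift q K)//; apply/cv/tame_shift.
have one_mul (b : nat -> R[i]) : b = (fun n => 1 * b n).
  by apply/funext => n; rewrite mul1r.
(* Both sides of the relation for [d] are summed at x; each contains x^2 q times the theta sum of
   [d] at x q^2, which cancels. *)
have hd : theta q d x = (1 + x) * theta q d (x * q).
  have L := thetaDZ q x 1 d (shift (shift d)) _ _ (cv d x dK)
    (dS _ x (tame_shift K d K1 dK)).
  have M := thetaDZ q x (x * q) (shift d + (fun n => 1 * dil q d n))
     (shift (dil q d)) _ _
     (thetaDZ q x 1 _ _ _ _ (dS d x dK) (cv _ x ddK)) (dS _ x ddK).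
  move: L M; rewrite -!one_mul -addrA -(cubic_coef_rel q (x * q) q1) -/d => L M.
  have := cvg_unique (@norm_hausdorff _ _) L M.
  rewrite !theta_dil (theta_shift q K)// !mul1r => E.
  apply: (addIr (x * (x * q * theta q d (x * q * q)))); rewrite {}E.
  by move: (theta q d _) (theta q d _) => s t; ring.
rewrite (cubic_coef_dil q x q1) -/d.
have := thetaDZ q x x d (shift d) _ _ (cv d x dK) (dS d x dK).
move/(cvg_lim (@norm_hausdorff _ _)); rewrite -/(theta _ _ _) => ->.
by rewrite hd expr2 !mulrDl mul1r mulrA.
Qed.

Lemma cubic_coef0 {R : realType} (q x : R[i]) : cubic_coef q x 0 = 1.
Proof.
rewrite /cubic_coef /conv !big_ord1 /euler_coef /cube_coef /= /qpoch !big_nil.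
by rewrite bin0n !expr0 !divr1 !mul1r.
Qed.

Lemma cvg_cubic {R : realType} (q u : R[i]) : `|q| < 1 ->
  ((fun n => \prod_(0 <= k < n) (1 + u * q ^+ k + u ^+ 2 * q ^+ (2 * k)))
    : nat -> R[i]^o) @ \oo --> theta q (cubic_coef q u) u.
Proof.
move=> q1.
have [K K1 HK] := tame_cubic q `|u| q1 (normr_ge0 u).
have [B HB] := theta_near0 q K `|u| q1 K1 (normr_ge0 u).
rewrite (_ : (fun n => _) = (fun n => \prod_(0 <= k < n)
    (1 + u * q ^+ k + (u * q ^+ k) ^+ 2) : R[i]^o)); last first.
  by apply/funext => n; apply: eq_bigr => k _; rewrite exprMn -exprM mulnC.
exact: (cvg_prod_qshift q u B (fun x => theta q (cubic_coef q x) x)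
  (fun x => 1 + x + x ^+ 2) q1 (fun x => theta_cubicE q x q1)
  (fun x xu => HB _ x (HK x xu) (cubic_coef0 q x) xu)).
Qed.

(** Euler's expansion of (u;q)_oo as the sum of (-1)^n q^(n choose 2) u^n / (q;q)_n, obtained by the
    same iteration. *)
Lemma cvg_qpoch {R : realType} (q u : R[i]) : `|q| < 1 ->
  (qpoch u q : nat -> R[i]^o) @ \oo --> (qpoch_inf u q : R[i]^o).
Proof.
move=> q1; set a := fun n => (-1) ^+ n / qpoch q q n : R[i].
have aK : tame (1 - `|q|)^-1 a.
  move=> n; rewrite /a normrM normrX normrN1 expr1n mul1r.
  exact: qpochV_le.
have K1 : 1 <= (1 - `|q|)^-1 by rewrite invf_ge1 ?subr_gt0// gerBl.
(* The generating function of [a] is 1 / (-z;q)_oo. *)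
have aE : a + shift a = dil q a.
  apply/funext => -[|n]; rewrite !fctE /dil /= ?addr0 ?expr0 ?mul1r// /a.
  have := qpoch_neq0 q n.+1 q1; rewrite qpochS -exprS exprS mulf_eq0 negb_or.
  by move=> /andP[n1 n2]; rewrite exprS; field; rewrite n1 n2.
have FE x : theta q a x = (1 - x) * theta q a (x * q).
  have := thetaDZ q x 1 a (shift a) _ _ (cvgn_theta q _ x a q1 K1 aK)
    (cvgn_theta q _ x _ q1 K1 (tame_shift _ a K1 aK)).
  have -> : (fun n => 1 * shift a n) = shift a.
    by apply/funext => n; rewrite mul1r.
  rewrite aE => /(cvg_lim (@norm_hausdorff _ _)); rewrite -/(theta _ _ _) theta_dil.
  rewrite (theta_shift q _ _ _ q1 K1 aK) mul1r => E.
  by move: (theta q a x) (theta q a _) E => s t E; rewrite mulrBl mul1r {1}E; ring.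
have [B HB] := theta_near0 q _ `|u| q1 K1 (normr_ge0 u).
have a0 : a 0%N = 1 by rewrite /a /qpoch big_nil expr0 divr1.
have cq : (qpoch u q : nat -> R[i]^o) @ \oo --> theta q a u.
  exact: (cvg_prod_qshift q u B (theta q a) (fun x => 1 - x) q1 FE
    (fun x => HB a x aK a0)).
by rewrite /qpoch_inf (cvg_lim (@norm_hausdorff _ _) cq).
Qed.

(** * Summation over triples *)

(** Summation over the triangle i + j < M, by columns instead of diagonals. *)
Lemma sum_conv {K : fieldType} (phi a b : nat -> K) (M : nat) :
  \sum_(n < M) phi n * conv a b n =
  \sum_(i < M) a i * \sum_(j < M - i) phi (i + j)%N * b j.
Proof.
elim: M => [|M IH]; first by rewrite !big_ord0.
rewrite big_ord_recr /= IH; under [RHS]eq_bigr => i _.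
  have iM : (i <= M)%N by rewrite -ltnS.
  rewrite subSn// big_ord_recr /= subnKC// mulrDr; over.
rewrite big_split /= big_ord_recr /= subnn big_ord0 mulr0 addr0; congr (_ + _).
by rewrite /conv big_distrr /=; apply: eq_bigr => i _; rewrite mulrCA.
Qed.

(** Only multiples of 3 contribute. The range [M] with a condition, in place of a range depending on
    [L], fits summation over a box. *)
Lemma sum_cube_coef {R : realType} (q : R[i]) (psi : nat -> R[i]) (L M : nat) :
  (L <= M)%N ->
  \sum_(m < L) psi m * cube_coef q m =
  \sum_(k < M) if (3 * k < L)%N
    then psi (3 * k)%N * ((-1) ^+ k / qpoch (q ^+ 3) (q ^+ 3) k) else 0.
Proof.
elim: L => [|L IH] LM; first by rewrite big_ord0 big1.
rewrite big_ord_recr /= IH 1?ltnW//.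
pose G k := psi (3 * k)%N * ((-1) ^+ k / qpoch (q ^+ 3) (q ^+ 3) k).
have -> : psi L * cube_coef q L = \sum_(k < M) if (3 * k == L)%N then G k else 0.
  rewrite /cube_coef; case: ifP => [/dvdnP[k LE]|nL].
    have kM : (k < M)%N by lia.
    rewrite (bigD1 (Ordinal kM)) //= LE mulnC eqxx mulKn//.
    rewrite big1 ?addr0// => i; rewrite -val_eqE /= => ik.
    by rewrite eqn_pmul2l// (negbTE ik).
  rewrite mulr0 big1// => k _; case: eqP => // kL.
  by rewrite -kL dvdn_mulr in nL.
rewrite -big_split /=; apply: eq_bigr => k _; rewrite ltnS [in RHS]leq_eqVlt.
case: eqP => [<-|_] /=; first by rewrite ltnn add0r.
by case: ifP; rewrite ?addr0.
Qed.

(** Writing 2i + j + 3k as i + N with N = i + j + 3k puts u^N with the Gaussian weight and u^i with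
    the first Euler factor. *)
Lemma summandE {R : realType} (u q : R[i]) (i j k : nat) :
  summand u q (i, j, k) =
  q ^+ 'C(i + j + 3 * k, 2) * u ^+ (i + j + 3 * k) *
  (u ^+ i * euler_coef q i) * euler_coef q j *
  ((-1) ^+ k / qpoch (q ^+ 3) (q ^+ 3) k).
Proof.
rewrite /summand qexpoE -exprnP /euler_coef.
have -> : (2 * i + j + 3 * k = i + (i + j + 3 * k))%N by lia.
rewrite !exprD !invfM; ring.
Qed.

Definition box (M : nat) : seq (nat * nat * nat) :=
  [seq (p, k) | p <- [seq (i, j) | i <- iota 0 M, j <- iota 0 M], k <- iota 0 M].

Lemma box_uniq (M : nat) : uniq (box M).
Proof.
by rewrite !allpairs_uniq ?iota_uniq// => -[? ?] [? ?].
Qed.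

Lemma mem_box (M i j k : nat) :
  (i < M)%N -> (j < M)%N -> (k < M)%N -> (i, j, k) \in box M.
Proof. by move=> iM jM kM; rewrite !allpairs_f ?mem_iota. Qed.

Lemma sum_box {V : nmodType} (F : nat * nat * nat -> V) (M : nat) :
  \sum_(t <- box M) F t =
  \sum_(i < M) \sum_(j < M) \sum_(k < M) F (val i, val j, val k).
Proof.
rewrite /box !big_allpairs /=.
have iotaE (G : nat -> V) : \sum_(i <- iota 0 M) G i = \sum_(i < M) G i.
  by rewrite -(big_mkord xpredT) /index_iota subn0.
rewrite iotaE; apply: eq_bigr => i _; rewrite iotaE; apply: eq_bigr => j _.
exact: iotaE.
Qed.

(** [sum_conv] unfolds both convolutions and [sum_cube_coef] the last index; the ranges are widened
    to the box under the condition i + j + 3k < M. *)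
Lemma sum_level_set {R : realType} (u q : R[i]) (M : nat) :
  \sum_(t <- box M | (t.1.1 + t.1.2 + 3 * t.2 < M)%N) summand u q t =
  series (theta_term q (cubic_coef q u) u) M.
Proof.
rewrite /series /= big_mkord /theta_term /cubic_coef.
rewrite (sum_conv (fun n => q ^+ 'C(n, 2) * u ^+ n)).
rewrite big_mkcond sum_box; apply: eq_bigr => i _ /=.
rewrite (sum_conv (fun n => q ^+ 'C(i + n, 2) * u ^+ (i + n))).
pose G j := euler_coef q j * \sum_(m < M - i - j)
  q ^+ 'C(i + (j + m), 2) * u ^+ (i + (j + m)) * cube_coef q m.
rewrite -[\sum_(j < M - i) _]/(\sum_(j < M - i) G j).
rewrite (big_ord_widen M G (leq_subr i M)) big_distrr [RHS]big_mkcond /=.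
apply: eq_bigr => j _; case: ifP => [ijM|ijM]; last first.
  by rewrite big1// => k _; case: ifP => //; lia.
rewrite /G (sum_cube_coef q (fun m => q ^+ 'C(i + (j + m), 2) * u ^+ (i + (j + m)))
  (M - i - j) M); last by lia.
rewrite !big_distrr /=; apply: eq_bigr => k _.
have -> : (3 * k < M - i - j)%N = (i + j + 3 * k < M)%N.
  by lia.
case: ifP => _; last by rewrite !mulr0.
rewrite -[LHS]/(summand u q (val i, val j, val k)) summandE -addnA; ring.
Qed.

(** * Unconditional convergence of the triple sum *)

Lemma ler_sum_subseq {K : numDomainType} {T : eqType} (A B : seq T) (F : T -> K) :
  uniq A -> uniq B -> {subset A <= B} -> (forall t, 0 <= F t) ->
  \sum_(t <- A) F t <= \sum_(t <- B) F t.
Proof.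
move=> uA uB AB F0; rewrite [leRHS](bigID (mem A)) /=.
have -> : \sum_(t <- B | t \in A) F t = \sum_(t <- A) F t.
  rewrite -big_filter; apply: perm_big; apply: uniq_perm => //.
    exact: filter_uniq.
  by move=> t; rewrite mem_filter; case: (boolP (t \in A)) => //= /AB ->.
by rewrite lerDl sumr_ge0.
Qed.

Lemma sum_box_half_le {R : realType} (M : nat) :
  \sum_(t <- box M) (2 ^+ t.1.1)^-1 * (2 ^+ t.1.2)^-1 * (2 ^+ t.2)^-1 <= 8 :> R[i].
Proof.
rewrite sum_box /=; set S := \sum_(i < M) (2 ^+ i)^-1 : R[i].
have -> : \sum_(i < M) \sum_(j < M) \sum_(k < M)
    (2 ^+ i)^-1 * (2 ^+ j)^-1 * (2 ^+ k)^-1 = S * S * S.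
  rewrite {1}/S -mulrA big_distrl /=; apply: eq_bigr => i _.
  rewrite {1}/S big_distrl big_distrr /=; apply: eq_bigr => j _.
  by rewrite /S !big_distrr /=; apply: eq_bigr => k _; rewrite mulrA.
have S2 : S <= 2 by rewrite /S -(big_mkord xpredT (fun i => (2 ^+ i)^-1)) sum_half_le.
have S0 : 0 <= S by apply: sumr_ge0 => i _; rewrite invr_ge0 exprn_ge0.
have -> : 8 = 2 * 2 * 2 :> R[i] by ring.
by rewrite !ler_pM ?mulr_ge0.
Qed.

(** The decay 4^-N is used twice over: one 2^-N makes the tail small, the other makes it summable
    over triples. *)
Lemma summand_bound {R : realType} (u q : R[i]) : `|q| < 1 ->
  exists2 C : R[i], 0 <= C & forall i j k,
    `|summand u q (i, j, k)| * 4 ^+ (i + j + 3 * k) <= C.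
Proof.
move=> q1; set V := (1 - `|q|)^-1; set K := (`|u| + 1) * V.
have V1 : 1 <= V by rewrite invf_ge1 ?subr_gt0// gerBl.
have U1 : 1 <= `|u| + 1 by rewrite lerDr.
have K1 : 1 <= K by rewrite mulr_ege1.
have K0 : 0 <= K by apply: le_trans K1.
have V0 : 0 <= V by apply: le_trans V1.
have VK : V <= K by rewrite ler_peMl.
have [C C0 HC] := gauss_bound q (4 * ((`|u| + 1) * K)) q1
  ltac:(by rewrite !mulr_gt0// ?(lt_le_trans ltr01)).
exists C => // i j k; apply: le_trans (HC (i + j + 3 * k)%N).
have cK := tame_le V K _ V0 VK (tame_cube q q1).
have fK := tame_euler q 1 (`|u| + 1) q1; rewrite normr1 in fK.
have eK := tame_euler q u (`|u| + 1) q1 ltac:(by rewrite lerDl).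
have := cK (3 * k)%N; rewrite /cube_coef dvdn_mulr// mulKn// => {}cK.
have := fK U1 j; rewrite expr1n mul1r -/V -/K => {}fK.
have {}eK := eK i; rewrite -/V -/K in eK.
clearbody K; rewrite summandE; move: cK fK eK; set N := (i + j + 3 * k)%N.
move: (u ^+ i * _) (euler_coef q j) (_ / _) => e f g cK fK eK.
have efg : `|e| * `|f| * `|g| <= K ^+ N.
  by rewrite /N (exprD K (i + j)) (exprD K i) !ler_pM ?mulr_ge0 ?normr_ge0.
rewrite !normrM !normrX !exprMn -!mulrA ler_wpM2l ?exprn_ge0// [leRHS]mulrCA.
apply: ler_pM; rewrite ?exprn_ge0// ?mulr_ge0 ?exprn_ge0//.
  by rewrite lerXn2r// ?nnegrE ?addr_ge0// lerDl.
by rewrite [leRHS]mulrC !mulrA ler_wpM2r ?exprn_ge0.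
Qed.

(** The sum over a finite set containing all triples with i + j + 3k < M is a partial sum of the
    theta series plus a tail of size at most 8 C 2^-M, whatever the set. *)
Lemma cvg_summand {R : realType} (u q : R[i]) : `|q| < 1 ->
  partial_sum (summand u q) @ totally --> theta q (cubic_coef q u) u.
Proof.
move=> q1; have [C C0 HC] := summand_bound u q q1.
have [K K1 HK] := tame_cubic q `|u| q1 (normr_ge0 u).
have cv := cvgn_theta q K u _ q1 K1 (HK u (lexx _)).
have FF := @totally_filter (nat * nat * nat)%type.
apply/cvgrPdist_lt => e e0.
have e2 : 0 < e / 2 by rewrite divr_gt0.
move/cvgrPdist_lt/(_ _ e2): cv => [n1 _ Hn1].
have C8 : 0 < 8 * C + 1 by rewrite ltr_wpDl// mulr_ge0.
have h1 : `|2^-1 : R[i]| < 1 by rewrite ger0_norm ?invr_ge0// invf_lt1// ltr1n.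
have [n2 Hn2] := expr_lt_eps (2^-1 : R[i]) (e / 2 / (8 * C + 1)) h1 (divr_gt0 e2 C8).
set M := maxn n1 n2.
pose P (t : nat * nat * nat) := (t.1.1 + t.1.2 + 3 * t.2 < M)%N.
exists [fset t in [seq t <- box M | P t]]%fset => //= A BA.
rewrite /partial_sum -(big_seq_fsetE _ A xpredT (summand u q)) /= (bigID P) /=.
have -> : \sum_(t <- A | P t) summand u q t = series (theta_term q (cubic_coef q u) u) M.
  rewrite -sum_level_set -!(big_filter _ P); apply: perm_big; apply: uniq_perm.
  - exact/filter_uniq/fset_uniq.
  - exact/filter_uniq/box_uniq.
  move=> [[i j] k]; rewrite !mem_filter; case: (boolP (P _)) => //= Pt.
  have tB : (i, j, k) \in box M by move: Pt; rewrite /P /= => Pt; apply: mem_box; lia.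
  by rewrite tB; apply: (fsubsetP BA); rewrite !inE mem_filter Pt tB.
rewrite opprD addrA (le_lt_trans (ler_normB _ _))// [ltRHS](splitr e) ltr_leD//.
  by apply: Hn1; rewrite /= leq_maxl.
pose v (t : nat * nat * nat) : R[i] := (2 ^+ t.1.1)^-1 * (2 ^+ t.1.2)^-1 * (2 ^+ t.2)^-1.
have v0 t : 0 <= v t by rewrite /v !mulr_ge0// invr_ge0 exprn_ge0.
(* Outside the level set N >= M, and N >= i + j + k always, so 4^-N <= 2^-M 2^-(i+j+k). *)
have sv t : ~~ P t -> `|summand u q t| <= C * 2^-1 ^+ M * v t.
  case: t => [[i j] k]; rewrite /P /= -leqNgt => Mt.
  have := HC i j k; rewrite -ler_pdivlMr ?exprn_gt0// => /le_trans; apply.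
  rewrite -mulrA ler_wpM2l// /v /= -!exprVn -!exprD.
  have -> : (4 : R[i]) = 2 ^+ 2 by ring.
  by rewrite -exprVn -exprM ler_wiXn2l ?invr_ge0// ?invf_le1// ?ler1n//; lia.
(* Enclosing [A] in some box bounds the sum of [v] by 8 independently of [L]. *)
have [L AL] : exists L, {subset A <= box L}.
  exists (\max_(t <- A) (t.1.1 + t.1.2 + t.2)).+1%N => -[[i j] k] tA.
  have /= H := @leq_bigmax_seq _ (enum_fset A) xpredT
    (fun t => t.1.1 + t.1.2 + t.2)%N _ tA isT.
  by apply: mem_box; lia.
apply: (@le_trans _ _ (\sum_(t <- A | ~~ P t) C * 2^-1 ^+ M * v t)).
  by rewrite (le_trans (ler_norm_sum _ _ _))// ler_sum.
apply: (@le_trans _ _ (\sum_(t <- A) C * 2^-1 ^+ M * v t)).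
  rewrite [leRHS](bigID P) /= lerDr sumr_ge0// => t _.
  by rewrite !mulr_ge0 ?exprn_ge0 ?invr_ge0.
have vL : \sum_(t <- A) v t <= 8.
  exact: le_trans (ler_sum_subseq _ _ v (fset_uniq A) (box_uniq L) AL v0)
    (sum_box_half_le L).
rewrite -big_distrr /= (@le_trans _ _ (C * 2^-1 ^+ M * 8))//.
  by rewrite ler_wpM2l// mulr_ge0 ?exprn_ge0 ?invr_ge0.
have := Hn2 M (leq_maxr _ _); rewrite ger0_norm ?invr_ge0// ltr_pdivlMr//.
move=> /ltW; apply: le_trans.
rewrite -mulrA mulrCA [C * 8]mulrC ler_wpM2l ?exprn_ge0 ?invr_ge0//.
by rewrite lerDl.
Qed.

(** * Comparison of the infinite products *)

Theorem theorem4p5 (R : realType) (q u : R[i]) (q_neq0 : 0 < `|q|)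
    (q_lt1 : `|q| < 1) :
  partial_sum (summand u q) @ totally --> (cubic_prod u q : R[i]^o)
  /\ (qpoch_inf u q != 0 ->
      cubic_prod u q = qpoch_inf (u ^+ 3) (q ^+ 3) / qpoch_inf u q).

Proof.
have Fu := cvg_cubic q u q_lt1.
have cE : cubic_prod u q = theta q (cubic_coef q u) u.
  exact: (cvg_lim (@norm_hausdorff _ _) Fu).
split; first by rewrite cE; exact: cvg_summand.
move=> u_neq0; apply: (canRL (mulfK u_neq0)).
have q3_lt1 : `|q ^+ 3| < 1 by apply: le_lt_trans (norm_exp3_le q q_lt1) q_lt1.
have cu : (qpoch (u ^+ 3) (q ^+ 3) : nat -> R[i]^o) @ \oo -->
    (cubic_prod u q * qpoch_inf u q : R[i]^o).
  (* Factor by factor, 1 - y^3 = (1 + y + y^2) (1 - y) with y = u q^k. *)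
  have -> : (qpoch (u ^+ 3) (q ^+ 3) : nat -> R[i]^o) = (fun n =>
      (\prod_(0 <= k < n) (1 + u * q ^+ k + u ^+ 2 * q ^+ (2 * k))) * qpoch u q n).
    apply/funext => n; rewrite /qpoch -big_split /=; apply: eq_bigr => k _.
    by rewrite -exprM mulnC exprM mulnC exprM; ring.
  by rewrite cE; apply: cvgM; [exact: Fu | exact: cvg_qpoch].
exact: (cvg_unique (@norm_hausdorff _ _) cu (cvg_qpoch _ _ q3_lt1)).
Qed.
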